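(* For all integers $n \geq 11$ not divisible by $3$, there exists a strongly non-Borda SWF on a set of voters $V$ with $|V|=n$ and candidate set $C=\{c_1,c_2,c_3\}$ satisfying conditions CC, MIIA, N, TA, P and PR.
   Context: Setting. $V$ is a finite set of voters, $C=\{c_1,c_2,c_3\}$ is the set of candidates, with indices treated modulo $3$. A ballot is a bijection $r:C\to\{0,1,2\}$ ($r^{-1}(2)$ is the highest ranked candidate, $r^{-1}(0)$ the lowest); it is also written as the list of candidates from highest to lowest. $\mathfrak{R}$ is the set of all ballots. The Condorcet cycle is $\mathfrak{C}=\{c_1c_2c_3,\ c_2c_3c_1,\ c_3c_1c_2\}\subset\mathfrak{R}$. An election domain is a subset $E\subset\mathfrak{R}^V$; its elements are elections $e$, with $e(v)$ the ballot of $v$. An election result $\succ$ is a weak ordering of $C$ (ties allowed). A SWF (social welfare function) is a function $F$ from $E$ to the set of weak orderings of $C$. Condition CC: $E=\mathfrak{C}^V$. For $i\ne j$ and $e\in E$ let $\pi_{i,j}(e)\in\mathbb{Z}^V$ be $\pi_{i,j}(e)(v)=e(v)(c_i)-e(v)(c_j)$, and let $A_{i,j}=\pi_{i,j}(E)$. Under CC, $A_{i,i+1}=\{1,-2\}^V$ and $A_{i+1,i}=\{2,-1\}^V$. For a result $\succ$, $\pi_{i,j}(\succ)=W$ if $c_i\succ c_j$, $L$ if $c_j\succ c_i$, and $T$ if they are tied. The symbols are ordered $W>T>L$. MIIA: for all $i\ne j$ there is a function (relative SWF) $f_{i,j}:A_{i,j}\to\{W,T,L\}$ with $f_{i,j}(\pi_{i,j}(e))=\pi_{i,j}(F(e))$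 for all $e\in E$. N (neutrality): for every permutation $\rho$ of $C$ and every $e\in E$ such that the election $\rho\circ e$ (obtained by relabelling the candidates in every ballot by $\rho$) lies in $E$, $F(\rho\circ e)=\rho(F(e))$, where $\rho$ acts on weak orderings by relabelling candidates. TA (transitive anonymity): there is a group $G$ acting transitively on $V$ such that $F(g(e))=F(e)$ for all $g\in G$, $e\in E$, where $g(e)(v)=e(g(v))$. P (Pareto, for SWFs satisfying MIIA): if $a\in A_{i,j}$ has $a(v)>0$ for all $v$, then $f_{i,j}(a)=W$. PR (positive responsiveness, for SWFs satisfying MIIA): for all $i\neq j$, if $a_1,a_2\in A_{i,j}$ and $a_1(v)\ge a_2(v)$ for all $v$, then $f_{i,j}(a_1)\ge f_{i,j}(a_2)$. Borda rules: for weights $w=(w_v)_{v\in V}\in\mathbb{R}^V$, the (weighted) Borda rule $B_w$ is the SWF ranking candidates by the score $b_w(c_i,e)=\sum_{v\in V}e(v)(c_i)\,w_v$ (higher score wins, equal scores tie). The tie rule is $B_w$ with $w\equiv0$, which always returns a three-way tie. A SWF $F$ is weakly Borda if there is $w\not\equiv0$ such that for all $e\in E$ and all $i\neq j$, $\pi_{i,j}(B_w(e))\ne T$ implies $\pi_{i,j}(F(e))=\pi_{i,j}(B_w(e))$. A SWF is strongly non-Borda if it is neither weakly Borda nor the tie rule. *)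

(* Defs.v *)
From HB Require Import structures.
From mathcomp Require Import all_boot all_order all_algebra all_fingroup.
From mathcomp Require Import reals.

Set Implicit Arguments.
Unset Strict Implicit.
Unset Printing Implicit Defensive.

Import Order.TTheory GRing.Theory Num.Theory.
Local Open Scope ring_scope.

(** The candidate set is [C = {c1, c2, c3} = 'I_3] and
    a ballot is a bijection [C -> {0, 1, 2}], hence a permutation of ['I_3]:
    [r c] is the number of points that [r] gives to the candidate [c]. *)
Notation candidate := 'I_3 (only parsing).
Notation ballot := {perm 'I_3} (only parsing).

Definition c1 : candidate := @Ordinal 3 0 isT.
Definition c2 : candidate := @Ordinal 3 1 isT.
Definition c3 : candidate := @Ordinal 3 2 isT.

(** The ballot written as a list, from the highest candidate to the lowest. *)
Definition ballot_list (r : ballot) : seq candidate :=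
  let s := (r^-1)%g in
  [:: s (@Ordinal 3 2 isT); s (@Ordinal 3 1 isT); s (@Ordinal 3 0 isT)].

Definition condorcet_cycle : {set ballot} :=
  [set r | ballot_list r \in
     [:: [:: c1; c2; c3]; [:: c2; c3; c1]; [:: c3; c1; c2]]].

Notation election V := {ffun V -> ballot} (only parsing).

Definition condorcet_domain (V : finType) : {set election V} :=
  [set e | e \in ffun_on (mem condorcet_cycle)].

(** Weak orderings of the candidates, given by their graph:
    [ranks o x y] means that [x] is ranked at least as high as [y]. *)
Definition is_weak_order (o : {ffun candidate * candidate -> bool}) : bool :=
  [forall x, forall y, o (x, y) || o (y, x)] &&
  [forall x, forall y, forall z, o (x, y) && o (y, z) ==> o (x, z)].

Definition weak_order : Type :=
  {o : {ffun candidate * candidate -> bool} | is_weak_order o}.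

Definition ranks (o : weak_order) (x y : candidate) : bool := val o (x, y).

Fact relabel_order_subproof (rho : {perm candidate}) (o : weak_order) :
  is_weak_order [ffun p => ranks o ((rho^-1)%g p.1) ((rho^-1)%g p.2)].
Proof.
rewrite /ranks; case: o => o /= /andP[/forallP o_total /forallP o_trans].
apply/andP; split; apply/forallP => x; apply/forallP => y.
  by rewrite !ffunE; exact: (forallP (o_total _)).
apply/forallP => z; rewrite !ffunE /=.
exact: (forallP (forallP (o_trans _) _)).
Qed.

(** [rho x] is at least as high as [rho y] in [relabel_order rho o] exactly when
    [x] is at least as high as [y] in [o]. *)
Definition relabel_order (rho : {perm candidate}) (o : weak_order) : weak_order :=
  exist (fun o => is_weak_order o) _ (relabel_order_subproof rho o).

Inductive outcome : Type := Win | Tie | Loss.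

Definition outcome_rank (s : outcome) : nat :=
  match s with Win => 2 | Tie => 1 | Loss => 0 end.

Definition outcome_ge (s t : outcome) : bool :=
  (outcome_rank t <= outcome_rank s)%N.

Definition result (i j : candidate) (o : weak_order) : outcome :=
  if ~~ ranks o j i then Win else if ~~ ranks o i j then Loss else Tie.

Section SocialWelfareFunctions.

Variables (V : finType) (E : {set election V}).

Definition swf : Type := {e : election V | e \in E} -> weak_order.

Definition CC : Prop := E = condorcet_domain V.

Definition margin (i j : candidate) (e : election V) : {ffun V -> int} :=
  [ffun v => (e v i : nat)%:Z - (e v j : nat)%:Z].

Definition margins (i j : candidate) : seq {ffun V -> int} :=
  [seq margin i j e | e in E].

Fact margin_in_subproof (i j : candidate) (e : {e : election V | e \in E}) :
  margin i j (val e) \in margins i j.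
Proof. exact: (image_f (margin i j) (valP e)). Qed.

Definition margin_in (i j : candidate) (e : {e : election V | e \in E}) :
  {a | a \in margins i j} := exist (fun a => a \in margins i j) _ (margin_in_subproof i j e).

Definition relative_swf (F : swf) (i j : candidate)
    (f : {a | a \in margins i j} -> outcome) : Prop :=
  forall e, f (margin_in i j e) = result i j (F e).

Definition MIIA (F : swf) : Prop :=
  forall i j : candidate, i != j ->
  exists f : {a | a \in margins i j} -> outcome, relative_swf F f.

(** Relabelling turns the ballot [x y z] into [(rho x) (rho y) (rho z)]; on point
    assignments this is [r \o rho^-1], which is [rho^-1 * r] since the product
    of permutations composes from left to right. *)
Definition relabel_election (rho : {perm candidate}) (e : election V) :
  election V := [ffun v => (rho^-1 * e v)%g].

Definition neutral (F : swf) : Prop :=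
  forall (rho : {perm candidate}) (e : {e : election V | e \in E})
    (rhoE : relabel_election rho (val e) \in E),
  F (exist (fun e => e \in E) _ rhoE) = relabel_order rho (F e).

Definition permute_election (gT : finGroupType) (to : {action gT &-> V})
  (g : gT) (e : election V) : election V := [ffun v => e (to v g)].

(** Only the permutations of the finite set [V] induced by the group matter, so
    restricting to finite groups loses no generality; nor do the library's right
    actions, as [to^~ g^-1] is the corresponding left action of [g].  The
    equation [F (g e) = F e] presupposes [g e \in E], hence the existential. *)
Definition transitively_anonymous (F : swf) : Prop :=
  exists (gT : finGroupType) (to : {action gT &-> V}),
    [transitive [set: gT], on [set: V] | to] /\
    forall (g : gT) (e : {e : election V | e \in E}),
    exists gE : permute_election to g (val e) \in E,
      F (exist (fun e => e \in E) _ gE) = F e.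

(** Under [MIIA] there is exactly one relative function for each pair [i != j]
    so that quantifying over all of them in the next two definitions just
    refers to it. *)
Definition pareto (F : swf) : Prop :=
  forall i j : candidate, i != j ->
  forall f : {a | a \in margins i j} -> outcome, relative_swf F f ->
  forall a : {a | a \in margins i j}, (forall v, 0 < val a v) -> f a = Win.

Definition positively_responsive (F : swf) : Prop :=
  forall i j : candidate, i != j ->
  forall f : {a | a \in margins i j} -> outcome, relative_swf F f ->
  forall a1 a2 : {a | a \in margins i j}, (forall v, val a2 v <= val a1 v) ->
  outcome_ge (f a1) (f a2).

End SocialWelfareFunctions.

Section Borda.

Variables (R : realType) (V : finType) (E : {set election V}).

Definition borda_score (w : {ffun V -> R}) (c : candidate) (e : election V) : R :=
  \sum_(v : V) (e v c : nat)%:R * w v.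

Fact score_order_subproof (s : candidate -> R) :
  is_weak_order [ffun p => s p.2 <= s p.1].
Proof.
apply/andP; split; apply/forallP => x; apply/forallP => y.
  by rewrite !ffunE /= le_total.
apply/forallP => z; rewrite !ffunE /=.
by apply/implyP => /andP[yx zy]; exact: le_trans zy yx.
Qed.

Definition score_order (s : candidate -> R) : weak_order :=
  exist (fun o => is_weak_order o) _ (score_order_subproof s).

Definition borda (w : {ffun V -> R}) : swf E :=
  fun e => score_order (fun c => borda_score w c (val e)).

Definition tie_rule : swf E := borda 0.

Definition weakly_borda (F : swf E) : Prop :=
  exists w : {ffun V -> R}, w != 0 /\
  forall (e : {e : election V | e \in E}) (i j : candidate), i != j ->
  result i j (borda w e) <> Tie ->
  result i j (F e) = result i j (borda w e).

Definition strongly_non_borda (F : swf E) : Prop :=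
  ~ weakly_borda F /\ ~ (F =1 tie_rule).

End Borda.

Arguments strongly_non_borda R {V E} F.

(* Main.v *)
(** The voters form the cyclic group of order n.  Take the unweighted Borda
    rule, which never ties since 3 does not divide n, and declare two candidates
    tied when the voters giving them a gap of two points form a translate of a
    fixed difference cover D of the group with |n - 3 #|D|| <= 1.  Translates of D
    meet pairwise and no ballot has a gap of two points for two different pairs, so at most
    one pair is tied; its Borda scores are consecutive, so the tie breaks neither
    transitivity nor monotonicity.  Such a D exists from n = 11 on: a sparse
    ruler when n is not 13, and the perfect difference set {0, 1, 3, 9} when
    n = 13. *)

Require Import Defs.
From HB Require Import structures.
From mathcomp Require Import all_boot all_order all_algebra all_fingroup.
From mathcomp Require Import reals.
From mathcomp Require Import zify lra.

Set Implicit Arguments.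
Unset Strict Implicit.
Unset Printing Implicit Defensive.

Import Order.TTheory GRing.Theory Num.Theory.
Local Open Scope ring_scope.

(** * Ballots of the Condorcet cycle and their point gaps *)

Lemma ord3P (P : 'I_3 -> Prop) : P c1 -> P c2 -> P c3 -> forall i, P i.
Proof.
move=> P1 P2 P3 [[|[|[|m]]] lt_m3] //.
- by have -> : Ordinal lt_m3 = c1 by apply: val_inj.
- by have -> : Ordinal lt_m3 = c2 by apply: val_inj.
- by have -> : Ordinal lt_m3 = c3 by apply: val_inj.
Qed.

Lemma condorcet_values (r : {perm 'I_3}) : r \in condorcet_cycle ->
  [\/ [/\ r c1 = c3, r c2 = c2 & r c3 = c1],
      [/\ r c1 = c1, r c2 = c3 & r c3 = c2] |
      [/\ r c1 = c2, r c2 = c1 & r c3 = c3]].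
Proof.
have rV x y : (r^-1)%g x = y -> r y = x by move=> <-; rewrite permKV.
rewrite inE /ballot_list !in_cons in_nil orbF.
by case/or3P => /eqP [] /rV h1 /rV h2 /rV h3; [apply: Or31|apply: Or32|apply: Or33];
  rewrite h1 h2 h3; split; apply: val_inj.
Qed.

Fact descending_inj (k : 'I_3) : injective (fun i : 'I_3 => k - i).
Proof. by move=> i j /addrI /oppr_inj. Qed.

(** With indices in [Z/3], these three maps are exactly the ballots of the Condorcet cycle. *)
Definition descending (k : 'I_3) : {perm 'I_3} := perm (@descending_inj k).

Lemma descending_condorcet (k : 'I_3) : descending k \in condorcet_cycle.
Proof.
have inv x : (descending k)^-1%g x = k - x.
  by apply: (canLR (permK _)); rewrite permE opprB addrC subrK.
rewrite inE /ballot_list !inv.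
by elim/ord3P: k {inv}.
Qed.

Lemma descending_values :
  [/\ descending c1 c1 = c1, descending c1 c2 = c3,
      descending c3 c1 = c3 & descending c3 c2 = c2].
Proof. by split; rewrite permE; apply: val_inj. Qed.

(** The sign of a one-point gap between [i] and [j]; on the cycle, a two-point gap has the opposite
    sign. *)
Definition orientation (i j : 'I_3) : int :=
  if j == i + 1 then 1 else -1.

Lemma orientationP (i j : 'I_3) : orientation i j = 1 \/ orientation i j = -1.
Proof. by rewrite /orientation; case: ifP; [left|right]. Qed.

Lemma condorcet_margin (r : {perm 'I_3}) (i j : 'I_3) :
  r \in condorcet_cycle -> i != j ->
  let a := (r i : nat)%:Z - (r j : nat)%:Z in
  a = orientation i j * (1 - 3 * (`|a| == 2)%:R).
Proof.
move=> /condorcet_values hr.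
by elim/ord3P: i; elim/ord3P: j => //=; case: hr => -[h1 h2 h3]; rewrite ?h1 ?h2 ?h3.
Qed.

(** Points are 0, 1 or 2, so both gaps would put [x] and [z] at the extreme opposite to [y]. *)
Lemma not_two_gaps_of_two (r : {perm 'I_3}) (x y z : 'I_3) : x != z ->
  `|(r x : nat)%:Z - (r y : nat)%:Z| = 2 ->
  `|(r y : nat)%:Z - (r z : nat)%:Z| = 2 -> False.
Proof.
move=> xz; have rxz : (r x != r z :> nat) by rewrite (inj_eq val_inj) (inj_eq perm_inj).
move: (ltn_ord (r x)) (ltn_ord (r y)) (ltn_ord (r z)) rxz; lia.
Qed.

(** * The rule whose ties are prescribed by a family [T] of voter sets *)

Section TieFamily.

Variables (V : finType) (T : {set {set V}}).

Definition large_gap (a : {ffun V -> int}) : {set V} := [set v | `|a v| == 2].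

Definition weak_pref (a : {ffun V -> int}) : bool :=
  (large_gap a \in T) || (0 <= \sum_v a v).

Definition outcome_of (a : {ffun V -> int}) : outcome :=
  if large_gap a \in T then Tie
  else if 0 < \sum_v a v then Win else if \sum_v a v < 0 then Loss else Tie.

Local Notation E := (condorcet_domain V).

Lemma marginN (i j : 'I_3) (e : {ffun V -> {perm 'I_3}}) :
  margin j i e = [ffun v => - margin i j e v].
Proof. by apply/ffunP => v; rewrite !ffunE opprB. Qed.

Lemma large_gapN (a : {ffun V -> int}) :
  large_gap [ffun v => - a v] = large_gap a.
Proof. by apply/setP => v; rewrite !inE ffunE normrN. Qed.

Lemma sum_ffunN (a : {ffun V -> int}) :
  \sum_v [ffun v => - a v] v = - \sum_v a v.
Proof. by rewrite -sumrN; apply: eq_bigr => v _; rewrite ffunE. Qed.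

Lemma sum_margin (e : {ffun V -> {perm 'I_3}}) (i j : 'I_3) :
  \sum_v margin i j e v = \sum_v (e v i : nat)%:Z - \sum_v (e v j : nat)%:Z.
Proof. by rewrite -sumrB; apply: eq_bigr => v _; rewrite ffunE. Qed.

Lemma condorcet_ballot (e : {ffun V -> {perm 'I_3}}) (v : V) :
  e \in E -> e v \in condorcet_cycle.
Proof. by rewrite inE => /ffun_onP/(_ v). Qed.

(** Up to a common sign each voter contributes 1, or 1 - 3 when the gap is two. Hence the sum is
    nonzero if 3 does not divide [#|V|], and two sums for the same pair differ by a multiple of
    3. *)
Lemma condorcet_sum_margin (e : {ffun V -> {perm 'I_3}}) (i j : 'I_3) :
  e \in E -> i != j ->
  \sum_v margin i j e v =
    orientation i j * (#|V|%:Z - 3 * #|large_gap (margin i j e)|%:Z).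
Proof.
move=> eE ij.
have -> : #|V|%:Z = \sum_(v : V) 1 by rewrite sumr_const cardT -cardE; lia.
have -> : #|large_gap (margin i j e)|%:Z = \sum_v (`|margin i j e v| == 2)%:R.
  rewrite -sum1_card -[LHS]intz big_mkcond sumMz /=.
  by apply: eq_bigr => v _; rewrite inE; case: ifP.
rewrite mulr_sumr -sumrB mulr_sumr; apply: eq_bigr => v _.
by rewrite {1}ffunE (condorcet_margin (condorcet_ballot v eE) ij) ffunE.
Qed.

Hypothesis T_intersecting : {in T &, forall A B, A :&: B != set0}.
Hypothesis T_card : {in T, forall A : {set V}, `|#|V|%:Z - 3 * #|A|%:Z| <= 1}.
Hypothesis V_not3 : ~~ (3 %| #|V|)%N.

Lemma sum_margin_neq0 (e : {ffun V -> {perm 'I_3}}) (i j : 'I_3) :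
  e \in E -> i != j -> \sum_v margin i j e v != 0.
Proof.
move=> eE ij; rewrite (condorcet_sum_margin eE ij).
by case: (orientationP i j) => ->; move: V_not3; lia.
Qed.

Lemma tied_sum_margin (e : {ffun V -> {perm 'I_3}}) (i j : 'I_3) :
  e \in E -> i != j -> large_gap (margin i j e) \in T ->
  `|\sum_v margin i j e v| <= 1.
Proof.
move=> eE ij /T_card; rewrite (condorcet_sum_margin eE ij).
by case: (orientationP i j) => ->; lia.
Qed.

Definition pref_graph (e : {ffun V -> {perm 'I_3}}) :
  {ffun 'I_3 * 'I_3 -> bool} := [ffun p => weak_pref (margin p.1 p.2 e)].

(* Two pairs of candidates are never tied by [T] simultaneously, and a tied
   pair has consecutive Borda scores, so no score lies strictly between. *)
Lemma pref_graph_weak_order (e : {ffun V -> {perm 'I_3}}) :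
  e \in E -> is_weak_order (pref_graph e).
Proof.
move=> eE; apply/andP; split; apply/forallP => x; apply/forallP => y.
  rewrite !ffunE /weak_pref /= (marginN x y) large_gapN sum_ffunN.
  by case: (_ \in T) => //=; lia.
apply/forallP => z; rewrite !ffunE /=; apply/implyP => /andP[].
have [->//|xy] := eqVneq x y.
have [->//|yz] := eqVneq y z.
have [<- _ _|xz] := eqVneq x z.
  by rewrite /weak_pref sum_margin subrr lexx orbT.
have sxy := sum_margin_neq0 eE xy; have syz := sum_margin_neq0 eE yz.
have txy := tied_sum_margin eE xy; have tyz := tied_sum_margin eE yz.
case/orP=> [Txy|hxy]; case/orP=> [Tyz|hyz].
- have /set0Pn[v] := T_intersecting Txy Tyz.
  rewrite !inE !ffunE => /andP[/eqP gxy /eqP gyz].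
  by case: (not_two_gaps_of_two xz gxy gyz).
(* The tied sum is at least -1 and the other, a nonzero nonnegative integer, at least 1; they add up
   to the sum for [x] and [z]. *)
- apply/orP; right; move: (txy Txy) sxy syz hyz; rewrite !sum_margin; lia.
- apply/orP; right; move: (tyz Tyz) sxy syz hxy; rewrite !sum_margin; lia.
- apply/orP; right; move: hxy hyz; rewrite !sum_margin; lia.
Qed.

Definition tie_family_rule : swf E :=
  fun e => exist (fun o => is_weak_order o) _ (pref_graph_weak_order (valP e)).

Local Notation F := tie_family_rule.

Lemma result_tie_family_rule (i j : 'I_3) (e : {e | e \in E}) :
  result i j (F e) = outcome_of (margin i j (val e)).
Proof.
rewrite /result /ranks /= !ffunE /weak_pref /outcome_of /= (marginN i j).
rewrite large_gapN sum_ffunN; case: (_ \in T) => //=.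
by rewrite oppr_ge0; case: ltgtP.
Qed.

Lemma tie_family_rule_MIIA : MIIA F.
Proof.
by move=> i j ij; exists (fun a => outcome_of (val a)) => e; rewrite result_tie_family_rule.
Qed.

Lemma margin_inP (i j : 'I_3) (a : {a | a \in margins E i j}) :
  exists e : {e | e \in E}, a = margin_in i j e.
Proof.
by have /imageP[e eE ae] := valP a; exists (exist _ e eE); apply: val_inj.
Qed.

Lemma tie_family_rule_relative (i j : 'I_3) (f : {a | a \in margins E i j} -> outcome) :
  relative_swf F f -> forall a, f a = outcome_of (val a).
Proof.
by move=> hf a; have [e ->] := margin_inP a; rewrite hf result_tie_family_rule.
Qed.

(** All ordered pairs are judged by the same function of their margin, and relabelling only carries
    margins from pair to pair. *)
Lemma tie_family_rule_neutral : neutral F.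
Proof.
move=> rho e rhoE; apply: val_inj; apply/ffunP => -[x y] /=.
rewrite !ffunE /ranks /= ffunE /=; congr weak_pref.
by apply/ffunP => v; rewrite !ffunE !permM.
Qed.

(** This makes [#|V| - 3] exceed 1, so that [T_card] keeps singletons out of [T]. *)
Hypothesis V_gt4 : (4 < #|V|)%N.

Lemma outcome_of_pos (i j : 'I_3)
    (e : {ffun V -> {perm 'I_3}}) : e \in E -> i != j ->
  1 < \sum_v margin i j e v -> outcome_of (margin i j e) = Win.
Proof.
move=> eE ij s_gt1; rewrite /outcome_of ifN; first by rewrite (lt_trans _ s_gt1).
by apply/negP => /(tied_sum_margin eE ij); lia.
Qed.

Lemma tie_family_rule_pareto : pareto F.
Proof.
move=> i j ij f /tie_family_rule_relative hf a; rewrite hf.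
have [e ->] := margin_inP a; move=> /= a_gt0.
apply: (outcome_of_pos (valP e) ij); apply: (@lt_le_trans _ _ #|V|%:Z).
  by lia.
have -> : #|V|%:Z = \sum_(v : V) 1 by rewrite sumr_const cardT -cardE; lia.
by apply: ler_sum => v _; rewrite -gtz0_ge1; exact: a_gt0.
Qed.

(* The sums of two comparable margins of a pair are congruent modulo 3, so they
   differ by at least 3 or the margins coincide. *)
Lemma outcome_of_margin_mono (i j : 'I_3) (e1 e2 : {ffun V -> {perm 'I_3}}) :
  e1 \in E -> e2 \in E -> i != j ->
  (forall v, margin i j e2 v <= margin i j e1 v) ->
  outcome_ge (outcome_of (margin i j e1)) (outcome_of (margin i j e2)).
Proof.
move=> e1E e2E ij le21.
have [s12|s12] := eqVneq (\sum_v margin i j e1 v) (\sum_v margin i j e2 v).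
  suff -> : margin i j e1 = margin i j e2 by case: outcome_of.
  have d0 : \sum_v (margin i j e1 v - margin i j e2 v) = 0.
    by rewrite sumrB s12 subrr.
  apply/ffunP => v; apply/eqP; rewrite -subr_eq0; apply/eqP.
  by apply: (psumr_eq0P _ d0) => // u _; rewrite subr_ge0.
have s_le : \sum_v margin i j e2 v <= \sum_v margin i j e1 v by apply: ler_sum.
have s_lt : \sum_v margin i j e2 v + 3 <= \sum_v margin i j e1 v.
  move: s12 s_le; rewrite !condorcet_sum_margin //.
  by case: (orientationP i j) => ->; lia.
have t1 := tied_sum_margin e1E ij; have t2 := tied_sum_margin e2E ij.
(* A tied sum lies in [-1, 1]; 3 more makes it positive, 3 less negative. *)
rewrite /outcome_of; case: (_ \in T) t1 => [/(_ isT) t1|_];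
  case: (_ \in T) t2 => [/(_ isT) t2|_];
  repeat case: ifP => //; lia.
Qed.

Lemma tie_family_rule_positively_responsive : positively_responsive F.
Proof.
move=> i j ij f /tie_family_rule_relative hf a1 a2; rewrite !hf.
have [e1 ->] := margin_inP a1; have [e2 ->] := margin_inP a2.
exact: outcome_of_margin_mono (valP e1) (valP e2) ij.
Qed.

(** * Test elections against weighted Borda rules *)

Variable R : realType.

(** Voters in [S] vote [c2 c3 c1], the others [c1 c2 c3]. Any set [S] thus becomes the set of voters
    with a two-point gap between [c1] and [c2]. *)
Definition split_election (S : {set V}) : {ffun V -> {perm 'I_3}} :=
  [ffun v => descending (if v \in S then c1 else c3)].

Lemma split_election_condorcet (S : {set V}) : split_election S \in E.
Proof. by rewrite inE; apply/ffun_onP => v; rewrite ffunE descending_condorcet. Qed.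

Definition split_in (S : {set V}) : {e | e \in E} :=
  exist (fun e => e \in E) _ (split_election_condorcet S).

Lemma large_gap_split (S : {set V}) :
  large_gap (margin c1 c2 (split_election S)) = S.
Proof.
by apply/setP => v; rewrite inE !ffunE !permE; case: (v \in S).
Qed.

Lemma borda_score_split (w : {ffun V -> R}) (S : {set V}) :
  borda_score w c1 (split_election S) - borda_score w c2 (split_election S) =
  \sum_v w v - 3 * \sum_(v in S) w v.
Proof.
rewrite /borda_score -sumrB [\sum_(v in S) _]big_mkcond mulr_sumr -sumrB.
apply: eq_bigr => v _; rewrite !ffunE -mulrBl.
have [d11 d12 d31 d32] := descending_values.
by case: (v \in S); rewrite ?d11 ?d12 ?d31 ?d32 /=; lra.
Qed.

Lemma result_borda_split (w : {ffun V -> R}) (S : {set V}) :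
  result c1 c2 (borda w (split_in S)) =
  if 3 * \sum_(v in S) w v < \sum_v w v then Win
  else if \sum_v w v < 3 * \sum_(v in S) w v then Loss else Tie.
Proof.
rewrite /result /ranks /= !ffunE /= -!ltNge.
rewrite -[X in if X then Win else _]subr_gt0 -[X in if X then Loss else _]subr_lt0.
by rewrite borda_score_split subr_gt0 subr_lt0.
Qed.

Lemma result_rule_split (S : {set V}) :
  result c1 c2 (F (split_in S)) =
  if S \in T then Tie else if (3 * #|S| < #|V|)%N then Win else Loss.
Proof.
rewrite result_tie_family_rule /outcome_of /= large_gap_split.
rewrite condorcet_sum_margin ?split_election_condorcet // large_gap_split.
rewrite [orientation _ _]/= mul1r; case: (S \in T) => //.
move: #|V| #|S| V_not3 => n m n_not3.
by repeat case: ifP => //; move=> *; exfalso; lia.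
Qed.

(** If everybody votes [c1 c2 c3], then [c1] beats [c2]. *)
Lemma tie_family_rule_not_tie : ~ F =1 @tie_rule R V E.
Proof.
move=> /(_ (split_in set0)) /(congr1 (result c1 c2)).
rewrite result_borda_split result_rule_split big_set0 cards0.
have /negbTE-> : set0 \notin T.
  by apply/negP => /T_card; rewrite cards0; move: V_gt4; lia.
have -> : (3 * 0 < #|V|)%N by move: V_gt4; lia.
rewrite (eq_bigr (fun=> 0)) => [|v _]; last by rewrite ffunE.
by rewrite big1 // mulr0 ltxx.
Qed.

(** * Transitive group action: anonymity and averaging of weights *)

Section Anonymity.

Variables (gT : finGroupType) (to : {action gT &-> V}).
Hypothesis to_transitive : [transitive [set: gT], on [set: V] | to].
Hypothesis T_invariant :
  forall (g : gT) (A : {set V}), A \in T -> [set v | to v g \in A] \in T.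

Lemma weak_pref_act (g : gT) (a : {ffun V -> int}) :
  weak_pref [ffun v => a (to v g)] = weak_pref a.
Proof.
rewrite /weak_pref.
have -> : \sum_v [ffun v => a (to v g)] v = \sum_v a v.
  rewrite [RHS](reindex_inj (act_inj to g)).
  by apply: eq_bigr => v _; rewrite ffunE.
congr (_ || _); have -> : large_gap [ffun v => a (to v g)] = [set v | to v g \in large_gap a].
  by apply/setP => v; rewrite !inE ffunE.
apply/idP/idP => [/(T_invariant g^-1)%g|]; last exact: T_invariant.
suff -> : [set v | to v g^-1%g \in [set v | to v g \in large_gap a]] = large_gap a.
  by [].
by apply/setP => v; rewrite !inE actKV.
Qed.

Lemma tie_family_rule_anonymous : transitively_anonymous F.
Proof.
exists gT, to; split=> // g e.
have gE : permute_election to g (val e) \in E.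
  by rewrite inE; apply/ffun_onP => v; rewrite ffunE condorcet_ballot ?(valP e).
exists gE; apply: val_inj; apply/ffunP => -[x y]; rewrite !ffunE /=.
rewrite -[RHS](weak_pref_act g); congr weak_pref.
by apply/ffunP => v; rewrite !ffunE.
Qed.

(** Let [K u] sum the weights of the images of [u] under the group; transitivity makes it a constant
    [k]. Summing the hypothesis over the group gives [3 * #|D| * k = #|gT| * W = #|V| * k], so [k]
    and then [W] vanish. *)
Lemma total_weight_eq0 (w : V -> R) (D : {set V}) :
  (forall g, 3 * \sum_(v | to v g \in D) w v = \sum_v w v) ->
  #|V| != (3 * #|D|)%N -> \sum_v w v = 0.
Proof.
set W := \sum_v w v => w_third VD.
pose K u := \sum_(g : gT) w (to u g).
have K_const u v : K u = K v.
  have /imsetP[x _ orb] := to_transitive.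
  have [h _ <-] : exists2 h, h \in [set: gT] & to u h = v.
    have := in_setT u; have := in_setT v; rewrite orb => /orbitP[b _ <-] /orbitP[c _ <-].
    by exists (c^-1 * b)%g; rewrite ?inE // actM actK.
  by rewrite /K (reindex_inj (mulgI h)); apply: eq_bigr => g _; rewrite actM.
have sumK : \sum_u K u = #|gT|%:R * W.
  rewrite exchange_big /= mulr_natl -sumr_const; apply: eq_bigr => g _.
  by rewrite [RHS](reindex_inj (act_inj to g)).
have sumKD : 3 * \sum_(u in D) K u = #|gT|%:R * W.
  rewrite exchange_big /= [RHS]mulr_natl -sumr_const mulr_sumr; apply: eq_bigr => g _.
  rewrite -(w_third g^-1%g); congr (_ * _).
  rewrite [RHS](reindex_inj (act_inj to g)) /=.
  by apply: eq_bigl => v; rewrite actK.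
have G_neq0 : #|gT|%:R != 0 :> R.
  by rewrite pnatr_eq0 -lt0n; apply/card_gt0P; exists 1%g.
have [V0|[u0 _]] := set_0Vmem [set: V].
  by rewrite /W big1 // => v _; have := in_setT v; rewrite V0 inE.
have KV : \sum_u K u = #|V|%:R * K u0.
  by rewrite mulr_natl -sumr_const; apply: eq_bigr => u _.
have KD : \sum_(u in D) K u = #|D|%:R * K u0.
  by rewrite mulr_natl -sumr_const; apply: eq_bigr => u _.
have : (#|V|%:R - (3 * #|D|)%:R) * K u0 = 0.
  by rewrite mulrBl natrM -mulrA -KV -KD sumK sumKD subrr.
move/eqP; rewrite mulf_eq0 subr_eq0 eqr_nat (negbTE VD) /= => /eqP K0.
by move/eqP: sumK; rewrite KV K0 mulr0 eq_sym mulf_eq0 (negbTE G_neq0) => /eqP.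
Qed.

(* If all sets in [T] tie then each has a third of the total weight, although
   it has not a third of the voters; averaging shows that the total weight is
   zero.  Since single voters never make [c1] lose, no weight is positive. *)
Lemma tie_family_rule_not_weakly_borda : T != set0 -> ~ weakly_borda R F.
Proof.
case/set0Pn=> D DT [w [/eqP w_neq0 hw]].
have w_third S : S \in T -> \sum_v w v = 3 * \sum_(v in S) w v.
  move=> ST; have := hw (split_in S) c1 c2 isT.
  rewrite result_borda_split result_rule_split ST.
  by case: ltgtP => // _ /(_ ltac:(discriminate)).
have W0 : \sum_v w v = 0.
  apply: (@total_weight_eq0 _ D) => [g|].
    by rewrite (w_third _ (T_invariant g DT)); under [in RHS]eq_bigl do rewrite inE.
  by move: V_not3; lia.
have w_le0 v : w v <= 0.
  have := hw (split_in [set v]) c1 c2 isT.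
  rewrite result_borda_split result_rule_split W0 big_set1 cards1.
  have /negbTE-> : [set v] \notin T.
    by apply/negP => /T_card; rewrite cards1; move: V_gt4; lia.
  have -> : (3 * 1 < #|V|)%N by move: V_gt4; lia.
  case: ltgtP => [h|h|h] h'; try lra.
  by have := h' ltac:(discriminate).
apply: w_neq0; apply/ffunP => v; rewrite ffunE; apply/eqP; rewrite -oppr_eq0.
have N0 : \sum_v - w v = 0 by rewrite sumrN W0 oppr0.
by apply/eqP; apply: (psumr_eq0P _ N0) => // u _; rewrite oppr_ge0.
Qed.

End Anonymity.

End TieFamily.

(** * Translates of a difference cover as tie family *)

Section Translates.

Variables (gT : finGroupType) (D : {set gT}).

Definition translates : {set {set gT}} := [set (D :* g)%g | g : gT].

Hypothesis D_cover : forall d : gT, exists x y, [/\ x \in D, y \in D & (y^-1 * x)%g = d].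

(** Writing [h * g^-1] as [y^-1 * x] with [x], [y] in [D] gives the common element
    [x * g = y * h]. *)
Lemma translates_intersecting :
  {in translates &, forall A B : {set gT}, A :&: B != set0}.
Proof.
move=> _ _ /imsetP[g _ ->] /imsetP[h _ ->].
have [x [y [xD yD def_d]]] := D_cover (h * g^-1)%g.
apply/set0Pn; exists (x * g)%g; rewrite inE !mem_rcoset mulgK xD /=.
suff -> : (x * g * h^-1 = y)%g by [].
by apply: (canLR (mulgK _)); apply: (canLR (mulgKV _)); rewrite -mulgA -def_d mulKVg.
Qed.

Lemma card_translates (A : {set gT}) : A \in translates -> #|A| = #|D|.
Proof. by case/imsetP=> g _ ->; rewrite card_rcoset. Qed.

Lemma translates_invariant (g : gT) (A : {set gT}) :
  A \in translates -> [set v | 'R%act v g \in A] \in translates.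
Proof.
case/imsetP=> h _ ->; apply/imsetP; exists (h * g^-1)%g => //.
by apply/setP => v; rewrite inE !mem_rcoset invMg invgK mulgA.
Qed.

(** The group itself is the set of voters; its right multiplication is transitive and permutes the
    translates of [D]. *)
Lemma difference_cover_rule (R : realType) :
  ~~ (3 %| #|gT|)%N -> (4 < #|gT|)%N -> `|#|gT|%:Z - 3 * #|D|%:Z| <= 1 ->
  exists (E : {set {ffun gT -> {perm 'I_3}}}) (F : swf E),
    strongly_non_borda R F /\ CC E /\ MIIA F /\ neutral F /\
    transitively_anonymous F /\ pareto F /\ positively_responsive F.
Proof.
move=> not3 gt4 cardD.
have T_card : {in translates, forall A : {set gT}, `|#|gT|%:Z - 3 * #|A|%:Z| <= 1}.
  by move=> A /card_translates ->.
have R_tr : [transitive [set: gT], on [set: gT] | 'R] by exact: (atransR [set: gT]%G).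
have T_neq0 : translates != set0.
  by apply/set0Pn; exists (D :* 1)%g; apply: imset_f.
exists (condorcet_domain gT).
exists (tie_family_rule translates_intersecting T_card not3).
split; [split|split; [by []|split; [|split; [|split; [|split]]]]].
- exact: (tie_family_rule_not_weakly_borda gt4 R_tr translates_invariant).
- exact: (tie_family_rule_not_tie gt4).
- exact: tie_family_rule_MIIA.
- exact: tie_family_rule_neutral.
- exact: (tie_family_rule_anonymous _ _ _ R_tr translates_invariant).
- exact: (tie_family_rule_pareto gt4).
- exact: tie_family_rule_positively_responsive.
Qed.

End Translates.

(** * Difference covers modulo [n] *)

Definition covers_mod (n : nat) (s : seq nat) : Prop :=
  forall d, (d < n)%N -> exists x y, [/\ x \in s, y \in s & x = y + d %[mod n]]%N.

(** If [d > L] then [n - d <= L], and swapping the two elements with difference [n - d] yields [d]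
    modulo [n]. *)
Lemma covers_modW (n : nat) (s : seq nat) (L : nat) :
  (n <= L.*2.+1)%N ->
  (forall d, (d <= L)%N -> exists2 y, y \in s & (y + d)%N \in s) ->
  covers_mod n s.
Proof.
move=> nL cov d dn; have [dL|Ld] := leqP d L.
  by have [y ys yds] := cov d dL; exists (y + d)%N, y.
have [|y ys yds] := cov (n - d)%N; first by lia.
exists y, (y + (n - d))%N; split=> //.
by rewrite -addnA subnK ?modnDr // ltnW.
Qed.

(* The three blocks of differences, [i], [2a-1-i] and [3a-1-i] with [i < a],
   cover [0, 3a-1]. *)
Definition sparse_ruler (a : nat) : seq nat := iota 0 a ++ [:: 2 * a - 1; 3 * a - 1]%N.

Lemma sparse_ruler_cover (a d : nat) : (1 < a)%N -> (d <= 3 * a - 1)%N ->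
  exists2 y, y \in sparse_ruler a & (y + d)%N \in sparse_ruler a.
Proof.
move=> a1 da; have [d_lt|d_ge] := ltnP d a.
  by exists 0%N; rewrite !(mem_cat, mem_iota, inE); lia.
have [d_lt2|d_ge2] := ltnP d (2 * a).
  by exists (2 * a - 1 - d)%N; rewrite !(mem_cat, mem_iota, inE); lia.
by exists (3 * a - 1 - d)%N; rewrite !(mem_cat, mem_iota, inE); lia.
Qed.

Lemma exists_difference_cover (n : nat) : (11 <= n)%N -> ~~ (3 %| n)%N ->
  exists s : seq nat, [/\ uniq s, all (fun x => x < n)%N s,
    `|n%:Z - 3 * (size s)%:Z| <= 1 & covers_mod n s].
Proof.
move=> n11 n3; have [->|n13] := eqVneq n 13%N.
  (* The 12 ordered pairs of distinct elements represent each nonzero residue modulo 13 once. *)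
  exists [:: 0; 1; 3; 9]%N; split=> // d.
  have witness : all (fun d => has (fun x => has (fun y => x == y + d %[mod 13])%N
      [:: 0; 1; 3; 9]%N) [:: 0; 1; 3; 9]%N) (iota 0 13) by [].
  move=> d13; have /(allP witness) : d \in iota 0 13 by rewrite mem_iota.
  by case/hasP=> x xs /hasP[y ys /eqP xy]; exists x, y.
(* The ruler has [a + 2] marks, the integer nearest to [n / 3]. Its differences reach [3 * a - 1],
   which suffices when [n <= 6 * a - 1]: this holds for [n = 11], where [a = 2], and whenever
   [a >= 3], but fails for 13, where [a = 2]. *)
pose a := ((n + 1) %/ 3 - 2)%N.
have a_bounds : (2 < a + 1 /\ 3 * a + 5 <= n <= 3 * a + 7)%N by rewrite /a; lia.
have sz : size (sparse_ruler a) = (a + 2)%N by rewrite size_cat size_iota.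
exists (sparse_ruler a); split.
- rewrite cat_uniq iota_uniq /= !mem_iota !inE; lia.
- rewrite all_cat /=; apply/and4P; split=> //; try lia.
  by apply/allP => x; rewrite mem_iota; lia.
- by rewrite sz; lia.
- apply: (@covers_modW _ _ (3 * a - 1)); first by lia.
  by move=> d; apply: sparse_ruler_cover; lia.
Qed.

Theorem mainTheorem1 (R : realType) (n : nat) (n_ge11 : (11 <= n)%N)
    (n_not3 : ~~ (3 %| n)%N) :
  exists V : finType, #|V| = n /\
  exists (E : {set election V}) (F : swf E),
    strongly_non_borda R F /\ CC E /\ MIIA F /\ neutral F /\
    transitively_anonymous F /\ pareto F /\ positively_responsive F.
Proof.
have [s [s_uniq s_lt s_size s_cov]] := exists_difference_cover n_ge11 n_not3.
(* The type ['I_n.+1] carries the cyclic group of addition modulo [n.+1]. *)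
case: n => [//|n] in n_ge11 n_not3 s_lt s_size s_cov *.
exists 'I_n.+1; split; first exact: card_ord.
pose D := [set x : 'I_n.+1 | (x : nat) \in s].
have cardD : #|D| = size s.
  rewrite cardE -(size_map val); apply/perm_size/uniq_perm => //.
    by rewrite (map_inj_uniq val_inj) enum_uniq.
  move=> x; apply/mapP/idP => [[y]|xs]; first by rewrite mem_enum inE => ys ->.
  have x_lt := allP s_lt _ xs.
  by exists (Ordinal x_lt); rewrite ?mem_enum ?inE.
apply: (@difference_cover_rule _ D); rewrite ?cardD ?card_ord //; last by lia.
move=> d; have [x [y [xs ys xyd]]] := s_cov d (ltn_ord d).
exists (Ordinal (allP s_lt _ xs)), (Ordinal (allP s_lt _ ys)); rewrite !inE.
(* In multiplicative notation [y^-1 * x = d] says that [x] is [y + d] modulo [n.+1]. *)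
split=> //; apply: (canLR (mulKg _)); apply: val_inj => /=.
by rewrite -xyd modn_small // (allP s_lt _ xs).
Qed.
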